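(* There is a constant $C>0$ such that for every $n\geq 2$ and every embedding of the link $L(n)$ in $[0,1]^3$ in which any two distinct components are at Euclidean distance at least $\varepsilon$, we have $\varepsilon\leq Cn^{-1/2}$.
   Context: $L(n)$ denotes the link consisting of $n$ distinct fibers of the Hopf fibration $S^3\to S^2$ (regarded as a link type in $[0,1]^3$); in particular every two-component sublink of $L(n)$ is a Hopf link. *)

(* Defs.v *)
From HB Require Import structures.
From mathcomp Require Import all_boot all_order all_algebra.
From mathcomp Require Import all_classical all_reals all_analysis.
From mathcomp Require Import Rstruct Rstruct_topology.
Set Implicit Arguments. Unset Strict Implicit. Unset Printing Implicit Defensive.
Import Order.TTheory GRing.Theory Num.Theory.
Local Open Scope ring_scope.
Local Open Scope classical_set_scope.

Definition RR := Rdefinitions.R.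
Definition pt3 := 'rV[RR]_3.
Definition pt4 := 'rV[RR]_4.

Definition crd (m : nat) (x : 'rV[RR]_m.+1) (k : nat) : RR := x ord0 (inord k).

Definition mk3 (a b c : RR) : pt3 := \row_(i < 3) nth 0 [:: a; b; c] i.
Definition mk4 (a b c d : RR) : pt4 := \row_(i < 4) nth 0 [:: a; b; c; d] i.

Definition eucl_dist (x y : pt3) : RR :=
  Num.sqrt (\sum_(i < 3) (x ord0 i - y ord0 i) ^+ 2).

Definition unit_cube : set pt3 := [set x | forall i, 0 <= x ord0 i <= 1].

Definition S3 : set pt4 := [set p | \sum_(i < 4) (p ord0 i) ^+ 2 = 1].

(* Hopf fiber through p = (z1, z2) = (p0 + i p1, p2 + i p3):
   { (e^{it} z1, e^{it} z2) | t real } *)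
Definition hopf_fiber (p : pt4) : set pt4 :=
  [set x | exists t : RR, x = mk4
     (crd p 0 * cos t - crd p 1 * sin t) (crd p 0 * sin t + crd p 1 * cos t)
     (crd p 2 * cos t - crd p 3 * sin t) (crd p 2 * sin t + crd p 3 * cos t)].

Definition north : pt4 := mk4 0 0 0 1.

Definition stereo (x : pt4) : pt3 :=
  mk3 (crd x 0 / (1 - crd x 3)) (crd x 1 / (1 - crd x 3)) (crd x 2 / (1 - crd x 3)).

Definition ambient_isotopy (H : RR -> pt3 -> pt3) : Prop :=
  {within [set q : RR * pt3 | 0 <= q.1 <= 1], continuous (fun q => H q.1 q.2)} /\
  (forall x, H 0 x = x) /\
  (forall t : RR, 0 <= t <= 1 ->
     continuous (H t) /\
     exists g : pt3 -> pt3, continuous g /\ cancel (H t) g /\ cancel g (H t)).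

(* K (a family of n subsets of R^3, the components) is a link of type L(n):
   it is ambient isotopic (component-wise) to the stereographic image of
   n distinct Hopf fibers (chosen to avoid the projection point). *)
Definition is_link_Ln (n : nat) (K : 'I_n -> set pt3) : Prop :=
  exists p : 'I_n -> pt4,
    (forall i, S3 (p i)) /\
    (forall i, ~ hopf_fiber (p i) north) /\
    (forall i j, i != j -> hopf_fiber (p i) <> hopf_fiber (p j)) /\
    exists H, ambient_isotopy H /\
      (forall i, H 1 @` (stereo @` hopf_fiber (p i)) = K i).

(* Main.v *)
(* Let A be one of the components.  If a component B misses the upward shadow
   { x + t e_z : x in A, t >= 0 }, then A can be pushed straight up out of the
   cube and contracted there, all in the complement of B.  Transporting this
   homotopy back by the inverse of the final homeomorphism of the isotopy
   contracts a Hopf fiber in the complement of another one.  But the complement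
   of the fiber of p maps to C \ 0 by x |-> x1 p2 - x2 p1, and this map sends
   every other fiber to a circle traversed once around 0, which is not
   null-homotopic: on a fine grid the number of quarter turns of the loop is
   invariant.  So every component meets the shadow of every other one.

   Cut the cube into about eps^-3 cells of diameter < eps.  Distinct components
   meet disjoint sets of cells, so some component meets at most about eps^-3 / n
   of them, and its shadow meets at most about eps^-4 / n cells.  The other n - 1
   components all meet the shadow, in distinct cells, so n^2 <= C eps^-4. *)
Require Import Defs.
From HB Require Import structures.
From mathcomp Require Import all_boot all_order all_algebra.
From mathcomp Require Import all_classical all_reals all_analysis.
From mathcomp Require Import Rstruct Rstruct_topology.
From mathcomp Require Import ring lra zify.
Import Order.TTheory GRing.Theory Num.Theory numFieldNormedType.Exports.
Local Open Scope ring_scope.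
Local Open Scope classical_set_scope.
Set Implicit Arguments. Unset Strict Implicit.

(** * Winding numbers of discrete and continuous plane loops *)

Definition dot {R : pzRingType} (z w : R * R) : R := z.1 * w.1 + z.2 * w.2.
Definition cross {R : pzRingType} (z w : R * R) : R := z.1 * w.2 - z.2 * w.1.

Definition quadrant {R : numDomainType} (z : R * R) : bool * bool :=
  (0 <= z.1, 0 <= z.2).
Definition rot90 (q : bool * bool) : bool * bool := (~~ q.2, q.1).
(* Quarter turns from [q] to [r], counted counterclockwise; junk value 0 when
   [q] and [r] are opposite. *)
Definition turn (q r : bool * bool) : int := (r == rot90 q)%:Z - (q == rot90 r)%:Z.

(** Any three distinct quadrants include an opposite pair, so [q], [r], [s] take at most two values,
    and [turn] is antisymmetric. *)
Lemma turn_add (q r s : bool * bool) :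
  r != rot90 (rot90 q) -> s != rot90 (rot90 r) -> s != rot90 (rot90 q) ->
  turn q r + turn r s = turn q s.
Proof. by case: q r s => [[] []] [[] []] [[] []]. Qed.

Lemma turn_eq0 (q r : bool * bool) :
  r != rot90 (rot90 q) -> turn q r = 0 -> q = r.
Proof. by case: q r => [[] []] [[] []]. Qed.

Lemma turn_ge0 (q r : bool * bool) : q != rot90 r -> 0 <= turn q r.
Proof. by case: q r => [[] []] [[] []]. Qed.

Section Plane.
Context {R : realDomainType}.
Implicit Types z w : R * R.

(** Points of opposite quadrants have both coordinate products nonpositive. Positive dot products
    thus keep [turn] away from its junk value. *)
Lemma quadrant_dot z w : 0 < dot z w -> quadrant w != rot90 (rot90 (quadrant z)).
Proof.
rewrite /dot /quadrant /rot90 /= => zw; apply/negP => /eqP [].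
by case: (lerP 0 z.1) => ?; case: (lerP 0 z.2) => ?; case: (lerP 0 w.1) => ?;
  case: (lerP 0 w.2) => ? //= _ _; nra.
Qed.

Lemma turn_cross_ge0 z w : 0 < cross z w -> 0 <= turn (quadrant z) (quadrant w).
Proof.
rewrite /cross => zw; apply: turn_ge0; rewrite /quadrant /rot90 /=.
apply/negP => /eqP [].
by case: (lerP 0 z.1) => ?; case: (lerP 0 z.2) => ?; case: (lerP 0 w.1) => ?;
  case: (lerP 0 w.2) => ? //= _ _; nra.
Qed.

Lemma quadrant_opp (z : R * R) (k l : R) : 0 < k -> 0 < l ->
  quadrant (- (k * z.1), - (k * z.2)) = quadrant (l * z.1, l * z.2) -> z = (0, 0).
Proof.
move=> k0 l0; rewrite /quadrant /= !oppr_ge0 => -[].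
rewrite !pmulr_rle0 // !pmulr_rge0 //; case: z => a b /=.
by case: (ltrgtP a 0) => // -> _; case: (ltrgtP b 0) => // ->.
Qed.

Definition winding (z : nat -> R * R) (n : nat) : int :=
  \sum_(b < n) turn (quadrant (z b)) (quadrant (z b.+1)).

(** The diagonal from [z b] to [w b.+1] cuts each square of the strip between the loops into two
    triangles, where [turn_add] applies. The difference of the windings telescopes and vanishes
    because both loops close up. *)
Lemma winding_step (z w : nat -> R * R) (n : nat) :
  (forall b, (b < n)%N -> [/\ 0 < dot (z b) (z b.+1), 0 < dot (w b) (w b.+1),
    0 < dot (z b) (w b), 0 < dot (z b.+1) (w b.+1) & 0 < dot (z b) (w b.+1)]) ->
  z n = z 0%N -> w n = w 0%N -> winding z n = winding w n.
Proof.
move=> zw zn wn; apply/eqP; rewrite -subr_eq0 /winding -sumrB; apply/eqP.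
transitivity (\sum_(0 <= b < n) (turn (quadrant (z b)) (quadrant (w b)) -
    turn (quadrant (z b.+1)) (quadrant (w b.+1)))).
  rewrite big_mkord; apply: eq_bigr => b _.
  have [z1 w1 zw0 zw1 d] := zw b (ltn_ord b).
  have e1 : turn (quadrant (z b)) (quadrant (z b.+1)) +
      turn (quadrant (z b.+1)) (quadrant (w b.+1)) =
      turn (quadrant (z b)) (quadrant (w b.+1)).
    by apply: turn_add; exact: quadrant_dot.
  have e2 : turn (quadrant (z b)) (quadrant (w b)) +
      turn (quadrant (w b)) (quadrant (w b.+1)) =
      turn (quadrant (z b)) (quadrant (w b.+1)).
    by apply: turn_add; exact: quadrant_dot.
  by lia.
rewrite -[RHS](subrr (turn (quadrant (z 0%N)) (quadrant (w 0%N)))).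
rewrite -{2}zn -{2}wn; elim: n {zw zn wn} => [|n IHn]; first by rewrite big_geq // subrr.
by rewrite big_nat_recr //= IHn; lia.
Qed.

Lemma winding_const (z : R * R) (n : nat) : winding (fun=> z) n = 0.
Proof. by rewrite /winding big1 // => b _; case: (quadrant z) => [[] []]. Qed.

(** A counterclockwise loop has only nonnegative turns; if they sum to zero, each of them is
    zero. *)
Lemma winding_eq0 (z : nat -> R * R) (n : nat) :
  (forall b, (b < n)%N -> 0 < dot (z b) (z b.+1)) ->
  (forall b, (b < n)%N -> 0 < cross (z b) (z b.+1)) ->
  winding z n = 0 -> forall b, (b <= n)%N -> quadrant (z b) = quadrant (z 0%N).
Proof.
move=> zdot zcross /eqP; rewrite psumr_eq0 => [/allP z0|b _]; last first.
  exact/turn_cross_ge0/zcross/ltn_ord.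
elim=> [//|b IHb bn]; rewrite -IHb ?(ltnW bn)//; apply/esym/turn_eq0.
  exact/quadrant_dot/zdot.
by apply/eqP/(z0 (Ordinal bn)); rewrite mem_index_enum.
Qed.

Lemma null_homotopic_grid_quadrant (z : nat -> nat -> R * R) (m n c : nat) :
  (forall a b a' b', (a <= a' <= a.+1)%N -> (b <= b' <= b.+1)%N ->
    (a' <= m)%N -> (b' <= n)%N -> 0 < dot (z a b) (z a' b')) ->
  (forall a, (a <= m)%N -> z a n = z a 0%N) ->
  (forall b, (b <= n)%N -> z m b = z m 0%N) ->
  (forall b, (b < n)%N -> 0 < cross (z 0%N b) (z 0%N b.+1)) ->
  (c <= n)%N -> quadrant (z 0%N c) = quadrant (z 0%N 0%N).
Proof.
move=> zdot zper zm zcross.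
apply: winding_eq0 => // [b bn|]; first by apply: zdot => //; lia.
have wm a : (a <= m)%N -> winding (z 0%N) n = winding (z a) n.
  elim: a => [//|a IHa am]; rewrite IHa ?(ltnW am)//.
  apply: winding_step => [b bn||].
  - by split; apply: zdot; lia.
  - by apply: zper; lia.
  - exact: zper.
rewrite (wm m)// -[RHS](winding_const (z m 0%N) n); apply: eq_bigr => b _.
by rewrite !zm // ltnW.
Qed.

End Plane.

Section Loops.
Context {R : realType}.

Lemma dot_self_gt0 (z : R * R) : z <> (0, 0) -> 0 < dot z z.
Proof.
case: z => a b ab0; rewrite /dot /=.
rewrite lt0r addr_ge0 -?expr2 ?sqr_ge0// andbT paddr_eq0 ?sqr_ge0//.
by rewrite !sqrf_eq0; apply/negP => /andP[/eqP a0 /eqP b0]; apply: ab0; rewrite a0 b0.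
Qed.

(** The condition is open and holds on the diagonal over [K]; compactness makes its radius uniform,
    as for a Lebesgue number. *)
Lemma dot_gt0_uniform (h : R * R -> R * R) (K : set (R * R)) :
  compact K -> continuous (fun x => (h x).1) -> continuous (fun x => (h x).2) ->
  (forall x, K x -> h x <> (0, 0)) ->
  exists2 e : R, 0 < e & forall x y, K x ->
    `|x.1 - y.1| < e -> `|x.2 - y.2| < e -> 0 < dot (h x) (h y).
Proof.
move=> /compact_near_coveringP cK c1 c2 h0.
pose P (e : R) x := forall y : R * R,
  `|x.1 - y.1| < e -> `|x.2 - y.2| < e -> 0 < dot (h x) (h y).
suff: \forall e \near 0^'+, K `<=` P e.
  move=> KP; near (0 : R)^'+ => e; exists e => // x y Kx.
  by apply: (near KP e).
apply: cK => x Kx.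
have dotc : continuous (fun z : (R * R) * (R * R) => dot (h z.1) (h z.2)).
  move=> z; rewrite /dot; apply: cvgD; apply: cvgM.
  - exact: (continuous_comp (@cvg_fst _ _ _ _ _) (c1 _)).
  - exact: (continuous_comp (@cvg_snd _ _ _ _ _) (c1 _)).
  - exact: (continuous_comp (@cvg_fst _ _ _ _ _) (c2 _)).
  - exact: (continuous_comp (@cvg_snd _ _ _ _ _) (c2 _)).
have dot0 : 0 < dot (h x) (h x).
  exact/dot_self_gt0/h0.
have : nbhs (x, x) [set z : (R * R) * (R * R) | 0 < dot (h z.1) (h z.2)].
  exact: cvgr_gt (dotc (x, x)) _ dot0.
rewrite -nbhs_ballE => -[r /= r0 rP].
near=> x' e => y /= xy1 xy2.
apply: (rP (x', y)).
have er : e < r / 2 by near: e; apply: nbhs_right_lt; rewrite divr_gt0.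
have [d1 d2] : ball x (r / 2) x'.
  by near: x'; apply: nbhsx_ballx; rewrite divr_gt0.
have r2 : r = r / 2 + r / 2 by rewrite -splitr.
split; split => /=.
- by apply: le_ball d1; lra.
- by apply: le_ball d2; lra.
- by rewrite r2; apply: ball_triangle d1 _; apply: lt_trans er.
- by rewrite r2; apply: ball_triangle d2 _; apply: lt_trans er.
Unshelve. all: by end_near. Qed.

(** On a fine grid, a contraction would force all samples of the initial circle into one quadrant,
    but those at angles 0 and [pi] point in opposite directions. The positive factor [l] allows a
    varying radius. *)
Lemma circle_not_null_homotopic (h : R * R -> R * R) (A : R) (l : R -> R) (c : R * R) :
  0 < A ->
  continuous (fun x => (h x).1) -> continuous (fun x => (h x).2) ->
  (forall t s : R, 0 <= t <= A -> 0 <= s <= pi *+ 2 -> h (t, s) <> (0, 0)) ->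
  (forall t : R, 0 <= t <= A -> h (t, pi *+ 2) = h (t, 0)) ->
  (forall s : R, 0 <= s <= pi *+ 2 -> h (A, s) = h (A, 0)) ->
  (forall s : R, 0 < l s) ->
  ~ (forall s : R, 0 <= s <= pi *+ 2 -> h (0, s) =
      (l s * (c.1 * trigo.cos s - c.2 * trigo.sin s),
       l s * (c.1 * trigo.sin s + c.2 * trigo.cos s))).
Proof.
move=> A0 c1 c2 h0 hper hA l0 h00.
have pi0 := @pi_gt0 R.
have cK : compact (`[0, A] `*` `[0, pi *+ 2] : set (R * R)).
  by apply: compact_setX; exact: segment_compact.
have [] := dot_gt0_uniform cK c1 c2.
  by move=> [t s] [/=]; rewrite !in_itv/=; exact: h0.
move=> e e0 he.
(* Both mesh sizes [A / 2k] and [pi / k] are at most [(A + pi) / k], hence below [e]. The extra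
   successor gives [2 <= k], so that [ds < pi] and [sin ds] is positive. With [2k] steps, the angle
   [pi] is the grid point of index [k]. *)
pose k := (Num.trunc ((A + pi) / e)).+2.
have k0 : 0 < k%:R :> R by rewrite ltr0n.
have ke : (A + pi) / k%:R < e.
  rewrite ltr_pdivrMr// mulrC -ltr_pdivrMr//.
  by apply: lt_trans (truncnS_gt _) _; rewrite ltr_nat.
have k2 : 2 <= k%:R :> R by rewrite ler_nat.
pose dt := A / k.*2%:R; pose ds := (pi : R) / k%:R.
have dt0 : 0 < dt by rewrite divr_gt0// ltr0n double_gt0.
have ds0 : 0 < ds by rewrite divr_gt0.
have dskE : k.*2%:R * ds = pi *+ 2.
  rewrite /ds -muln2 natrM -[RHS]mulr_natr; field; exact/lt0r_neq0.
have dtkE : k.*2%:R * dt = A by rewrite mulrC divfK// pnatr_eq0 double_eq0.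
have ds1 : ds < pi by rewrite /ds ltr_pdivrMr// ltr_pMr//; lra.
have dse : ds < e.
  by apply: le_lt_trans ke; rewrite ler_pM2r ?invr_gt0//; lra.
have dte : dt < e.
  apply: le_lt_trans ke; rewrite ler_pM ?invr_ge0 ?(ltW A0)//; first by lra.
  by rewrite lef_pV2 ?posrE ?ltr0n ?double_gt0// ler_nat -addnn leq_addr.
pose z a b := h (a%:R * dt, b%:R * ds).
have tA a : (a <= k.*2)%N -> 0 <= a%:R * dt <= A.
  by move=> ak; rewrite mulr_ge0 ?(ltW dt0)//= -dtkE ler_pM2r// ler_nat.
have sA b : (b <= k.*2)%N -> 0 <= b%:R * ds <= pi *+ 2.
  by move=> bk; rewrite mulr_ge0 ?(ltW ds0)//= -dskE ler_pM2r// ler_nat.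
have step (d : R) a a' : 0 < d -> d < e -> (a <= a' <= a.+1)%N ->
    `|a%:R * d - a'%:R * d| < e.
  move=> d0 de /andP[aa' a'a]; rewrite -mulrBl normrM (gtr0_norm d0).
  apply: le_lt_trans de; rewrite ler_piMl ?(ltW d0)// distrC -natrB// normr_nat.
  by rewrite (ler_nat _ _ 1) leq_subLR addn1.
have c0 : c <> (0, 0).
  have s0 : (0 : R) <= 0 <= (pi : R) *+ 2.
    by apply/andP; split; [exact: lexx|exact/mulrn_wge0/ltW].
  move=> c0; apply: (h0 0 0) => //; first by rewrite lexx/= ltW.
  by rewrite h00// c0/= !mul0r subrr addr0 mulr0.
apply: (c0); have {}h00 b : (b <= k.*2)%N -> z 0%N b =
      (l (b%:R * ds) * (c.1 * trigo.cos (b%:R * ds) - c.2 * trigo.sin (b%:R * ds)),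
       l (b%:R * ds) * (c.1 * trigo.sin (b%:R * ds) + c.2 * trigo.cos (b%:R * ds))).
  by move=> bk; rewrite /z mul0r h00// sA.
have : quadrant (z 0%N k) = quadrant (z 0%N 0%N).
  apply: (@null_homotopic_grid_quadrant _ z k.*2 k.*2).
  - move=> a b a' b' aa' bb' a'k b'k; apply: he => /=; last 2 first.
    + exact: step.
    + exact: step.
    + split; rewrite /= in_itv/=; [apply: tA|apply: sA].
        by case/andP: aa' => /leq_trans ->.
      by case/andP: bb' => /leq_trans ->.
  - by move=> a ak; rewrite /z dskE mul0r hper// tA.
  - by move=> b bk; rewrite /z dtkE mul0r hA// sA.
  - move=> b bk.
    have bk1 := ltnW bk; rewrite !h00 // -natr1 mulrDl mul1r.
    move: (b%:R * ds) => s; rewrite trigo.cosD trigo.sinD /cross /=.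
    rewrite [ltRHS](_ : _ = l s * l (s + ds) * (dot c c * trigo.sin ds) *
        (trigo.cos s ^+ 2 + trigo.sin s ^+ 2)); last by rewrite /dot; ring.
    by rewrite cos2Dsin2 mulr1 !mulr_gt0 ?dot_self_gt0 ?sin_gt0_pi ?ds0.
  - by rewrite -addnn leq_addr.
rewrite !h00 ?leq0n -?addnn ?leq_addr//.
have -> : k%:R * ds = pi by rewrite mulrC divfK// gt_eqF.
rewrite mul0r cospi sinpi cos0 sin0 !(mulr0, mulr1, mulrN1, subr0, addr0, add0r, mulrN).
exact: quadrant_opp.
Qed.

End Loops.

(** * Hopf fibers *)

Lemma crd_mk4 (a b c d : RR) :
  (crd (mk4 a b c d) 0 = a) * (crd (mk4 a b c d) 1 = b) *
  (crd (mk4 a b c d) 2 = c) * (crd (mk4 a b c d) 3 = d).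
Proof. by rewrite /crd /mk4 !mxE !inordK. Qed.

Lemma crd_mk3 (a b c : RR) :
  (crd (mk3 a b c) 0 = a) * (crd (mk3 a b c) 1 = b) * (crd (mk3 a b c) 2 = c).
Proof. by rewrite /crd /mk3 !mxE !inordK. Qed.

Lemma mk4_crd (x : pt4) : x = mk4 (crd x 0) (crd x 1) (crd x 2) (crd x 3).
Proof.
apply/rowP => i; rewrite /mk4 mxE /crd; case: i => -[|[|[|[|//]]]] lti /=;
  by congr (x _ _); apply/val_inj; rewrite /= inordK.
Qed.

Lemma mk3_crd (x : pt3) : x = mk3 (crd x 0) (crd x 1) (crd x 2).
Proof.
apply/rowP => i; rewrite /mk3 mxE /crd; case: i => -[|[|[|//]]] lti /=;
  by congr (x _ _); apply/val_inj; rewrite /= inordK.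
Qed.

Lemma S3_crd (x : pt4) :
  S3 x <-> crd x 0 ^+ 2 + crd x 1 ^+ 2 + crd x 2 ^+ 2 + crd x 3 ^+ 2 = 1.
Proof.
rewrite /S3 /=; set s := \sum_(i < 4) _.
suff -> : s = crd x 0 ^+ 2 + crd x 1 ^+ 2 + crd x 2 ^+ 2 + crd x 3 ^+ 2 by [].
rewrite /s (mk4_crd x) !crd_mk4 !big_ord_recl big_ord0 !mxE /=.
by rewrite addr0 !addrA.
Qed.

Definition hopf_rot (p : pt4) (t : RR) : pt4 := mk4
  (crd p 0 * cos t - crd p 1 * sin t) (crd p 0 * sin t + crd p 1 * cos t)
  (crd p 2 * cos t - crd p 3 * sin t) (crd p 2 * sin t + crd p 3 * cos t).

(* In complex coordinates this is [x1 p2 - x2 p1]; on the sphere it vanishes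
   exactly on the fiber of [p], and it is multiplied by [e^{it}] along the
   fibers. *)
Definition hopf_det (p x : pt4) : RR * RR :=
  (crd x 0 * crd p 2 - crd x 1 * crd p 3 - (crd x 2 * crd p 0 - crd x 3 * crd p 1),
   crd x 0 * crd p 3 + crd x 1 * crd p 2 - (crd x 2 * crd p 1 + crd x 3 * crd p 0)).

Lemma hopf_det_rot (p q : pt4) (t : RR) : hopf_det p (hopf_rot q t) =
  ((hopf_det p q).1 * cos t - (hopf_det p q).2 * sin t,
   (hopf_det p q).1 * sin t + (hopf_det p q).2 * cos t).
Proof. by rewrite /hopf_det /hopf_rot !crd_mk4 /=; congr (_, _); ring. Qed.

Lemma S3_rot (p : pt4) (t : RR) : S3 p -> S3 (hopf_rot p t).
Proof.
rewrite !S3_crd /hopf_rot !crd_mk4 => p1.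
rewrite [LHS](_ : _ = (crd p 0 ^+ 2 + crd p 1 ^+ 2 + crd p 2 ^+ 2 + crd p 3 ^+ 2) *
  (cos t ^+ 2 + sin t ^+ 2)); last by ring.
by rewrite p1 cos2Dsin2 mulr1.
Qed.

Lemma exists_angle (R : realType) (a b : R) :
  a ^+ 2 + b ^+ 2 = 1 -> exists t : R, cos t = a /\ sin t = b.
Proof.
move=> ab1.
have a1 : -1 <= a <= 1.
  by apply/andP; split; nra.
have sb : Num.sqrt (1 - a ^+ 2) = `|b| by rewrite -ab1 addrC addKr sqrtr_sqr.
have [b0|/ltW b0] := lerP 0 b.
  by exists (acos a); rewrite acosK// sin_acos// sb ger0_norm.
by exists (- acos a); rewrite cosN sinN acosK// sin_acos// sb ler0_norm// opprK.
Qed.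

Lemma hopf_det_eq0 (p x : pt4) :
  S3 p -> S3 x -> hopf_det p x = (0, 0) -> hopf_fiber p x.
Proof.
rewrite !S3_crd /hopf_det => p1 x1 [e1 e2].
(* The angle is the argument of the Hermitian product of [x] and [p]. *)
have [t [ct st]] : exists t, cos t = crd x 0 * crd p 0 + crd x 1 * crd p 1 +
      (crd x 2 * crd p 2 + crd x 3 * crd p 3) /\
    sin t = crd x 1 * crd p 0 - crd x 0 * crd p 1 +
      (crd x 3 * crd p 2 - crd x 2 * crd p 3).
  apply: exists_angle; move: p1 x1 e1 e2.
  move: (crd p 0) (crd p 1) (crd p 2) (crd p 3) (crd x 0) (crd x 1) (crd x 2) (crd x 3).
  move=> p0 p1 p2 p3 x0 x1 x2 x3 pp xx e1 e2.
  (* Lagrange's identity: the squared modulus of the Hermitian product is the product of the squared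
     norms minus that of the determinant. *)
  rewrite [LHS](_ : _ = (p0 ^+ 2 + p1 ^+ 2 + p2 ^+ 2 + p3 ^+ 2) *
    (x0 ^+ 2 + x1 ^+ 2 + x2 ^+ 2 + x3 ^+ 2) -
    ((x0 * p2 - x1 * p3 - (x2 * p0 - x3 * p1)) ^+ 2 +
     (x0 * p3 + x1 * p2 - (x2 * p1 + x3 * p0)) ^+ 2)); last by ring.
  by rewrite pp xx e1 e2 expr0n /= addr0 subr0 mulr1.
exists t; rewrite [LHS]mk4_crd ct st; move: p1 e1 e2 {x1 ct st}.
move: (crd p 0) (crd p 1) (crd p 2) (crd p 3) (crd x 0) (crd x 1) (crd x 2) (crd x 3).
move=> p0 p1 p2 p3 x0 x1 x2 x3 pp e1 e2.
set d1 := (X in X = 0) in e1; set d2 := (X in X = 0) in e2.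
(* Each coordinate of the Hermitian product times [p] is that of [x] times the squared norm of [p],
   plus a combination of [d1] and [d2]; [u] and [v] are its coefficients. *)
have E (a b u v : RR) :
    b = a * (p0 ^+ 2 + p1 ^+ 2 + p2 ^+ 2 + p3 ^+ 2) + d1 * u + d2 * v -> a = b.
  by move=> ->; rewrite pp e1 e2 !mul0r !addr0 mulr1.
congr mk4.
- by apply: (E _ _ (- p2) (- p3)); rewrite /d1 /d2; ring.
- by apply: (E _ _ p3 (- p2)); rewrite /d1 /d2; ring.
- by apply: (E _ _ p0 p1); rewrite /d1 /d2; ring.
- by apply: (E _ _ (- p1) p0); rewrite /d1 /d2; ring.
Qed.

(* The inverse of [stereo] multiplied by the positive factor [|y|^2 + 1]: only the
   direction of its [hopf_det] matters, and this form is polynomial. *)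
Definition unstereo (y : pt3) : pt4 :=
  mk4 (crd y 0 *+ 2) (crd y 1 *+ 2) (crd y 2 *+ 2)
      (crd y 0 ^+ 2 + crd y 1 ^+ 2 + crd y 2 ^+ 2 - 1).

Lemma hopf_det_scale (p x : pt4) (k : RR) : hopf_det p
    (mk4 (k * crd x 0) (k * crd x 1) (k * crd x 2) (k * crd x 3)) =
  (k * (hopf_det p x).1, k * (hopf_det p x).2).
Proof. by rewrite /hopf_det !crd_mk4; congr (_, _) => /=; ring. Qed.

Lemma S3_lt1 (x : pt4) : S3 x -> x <> north -> crd x 3 < 1.
Proof.
rewrite S3_crd [x]mk4_crd !crd_mk4 /north.
move: (crd x 0) (crd x 1) (crd x 2) (crd x 3) => a b c d x1 xn.
have d1 : d <= 1 by nra.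
rewrite lt_neqAle d1 andbT; apply/eqP => dE; apply: xn.
have z0 (u v w : RR) : u ^+ 2 + v ^+ 2 + w ^+ 2 = 0 -> u = 0.
  by move=> uvw; apply/eqP; rewrite -sqrf_eq0; apply/eqP; nra.
have s0 : a ^+ 2 + b ^+ 2 + c ^+ 2 = 0.
  by move: x1; rewrite dE expr1n => /(canRL (addrK _)); rewrite subrr.
have a0 : a = 0 by exact: (z0 a b c).
have b0 : b = 0 by apply: (z0 b c a); rewrite -s0; ring.
have c0 : c = 0 by apply: (z0 c a b); rewrite -s0; ring.
by rewrite dE a0 b0 c0.
Qed.

(** The factor [k] is [|y|^2 + 1] for [y = stereo x]. *)
Lemma unstereoK (x : pt4) : S3 x -> x <> north ->
  let k := 2 / (1 - crd x 3) in
  unstereo (stereo x) = mk4 (k * crd x 0) (k * crd x 1) (k * crd x 2) (k * crd x 3).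
Proof.
move=> xS xn k; have x3 := S3_lt1 xS xn; move: xS; rewrite S3_crd => xS.
rewrite /unstereo /stereo !crd_mk3 /k.
move: (crd x 0) (crd x 1) (crd x 2) (crd x 3) xS x3 => a b c d x1 d1.
have d0 : 1 - d != 0 by rewrite subr_eq0 gt_eqF.
congr mk4; try by field.
have -> : (a / (1 - d)) ^+ 2 + (b / (1 - d)) ^+ 2 + (c / (1 - d)) ^+ 2 =
   (1 - d ^+ 2) / (1 - d) ^+ 2.
  have -> : 1 - d ^+ 2 = a ^+ 2 + b ^+ 2 + c ^+ 2 by rewrite -x1 addrK.
  by field.
by field.
Qed.

(** Normalizing [unstereo y] gives a point of the sphere that projects to [y]. Hence the determinant
    sends the complement of the projected fiber into the punctured plane. *)
Lemma hopf_det_unstereo_eq0 (p : pt4) (y : pt3) : S3 p ->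
  hopf_det p (unstereo y) = (0, 0) -> (stereo @` hopf_fiber p) y.
Proof.
move=> pS y0; set N := crd y 0 ^+ 2 + crd y 1 ^+ 2 + crd y 2 ^+ 2.
have N0 : 0 <= N by rewrite !addr_ge0 ?sqr_ge0.
have N1 : N + 1 != 0 by rewrite gt_eqF// ltr_wpDl.
pose u := unstereo y.
exists (mk4 ((N + 1)^-1 * crd u 0) ((N + 1)^-1 * crd u 1)
  ((N + 1)^-1 * crd u 2) ((N + 1)^-1 * crd u 3)).
  apply: hopf_det_eq0 => //; last by rewrite hopf_det_scale y0 /= !mulr0.
  rewrite S3_crd /u /unstereo !crd_mk4 -/N.
  rewrite [LHS](_ : _ = (N *+ 4 + (N - 1) ^+ 2) / (N + 1) ^+ 2); first by field.
  by rewrite /N; field.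
rewrite [RHS]mk3_crd /u /unstereo /stereo !crd_mk4 -/N.
have -> : 1 - (N + 1)^-1 * (N - 1) = 2 / (N + 1) by field.
by congr mk3; field.
Qed.

(** * Linked fibers meet each other's shadow *)

Section Continuity.
Variable T : topologicalType.
Implicit Types f g : T -> RR.

Lemma continuous_add f g :
  continuous f -> continuous g -> continuous (fun x => f x + g x).
Proof. by move=> cf cg x; exact: (@cvgD RR RR^o _ _ _ _ _ _ _ (cf x) (cg x)). Qed.

Lemma continuous_sub f g :
  continuous f -> continuous g -> continuous (fun x => f x - g x).
Proof. by move=> cf cg x; exact: (@cvgB RR RR^o _ _ _ _ _ _ _ (cf x) (cg x)). Qed.

Lemma continuous_mul f g :
  continuous f -> continuous g -> continuous (fun x => f x * g x).
Proof. by move=> cf cg x; exact: (@cvgM RR _ _ _ _ _ _ _ (cf x) (cg x)). Qed.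

Lemma continuous_inv f :
  (forall x, f x != 0) -> continuous f -> continuous (fun x => (f x)^-1).
Proof. by move=> f0 cf x; exact: (@cvgV RR _ _ _ _ _ (f0 x) (cf x)). Qed.

Lemma continuous_cst (a : RR) : continuous (fun _ : T => a).
Proof. by move=> x; exact: cvg_cst. Qed.

Lemma continuous_compose (U V : topologicalType) (k : U -> V) (h : T -> U) :
  continuous h -> continuous k -> continuous (fun x => k (h x)).
Proof. by move=> ch ck x; exact: (continuous_comp (ch x) (ck _)). Qed.

Lemma continuous_row (n : nat) (h : T -> 'rV[RR]_n) :
  (forall i, continuous (fun t => h t ord0 i)) -> continuous h.
Proof.
move=> fc t A [P tP PA]; rewrite nbhs_filterE.
have : \forall x \near t, forall i, P ord0 i (h x ord0 i).
  by apply: filter_forall => i; exact: fc (tP ord0 i).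
by apply: filterS => x Px; apply: PA => i j; rewrite (ord1 i).
Qed.

End Continuity.

Lemma continuous_coord (n : nat) (i : 'I_n) :
  continuous (fun x : 'rV[RR]_n => x ord0 i).
Proof. by move=> x; exact: (@coord_continuous RR _ _ ord0 i x). Qed.

Lemma continuous_crd (n k : nat) : continuous (fun x : 'rV[RR]_n.+1 => crd x k).
Proof. exact: continuous_coord. Qed.

Lemma continuous_stereo_rot (q : pt4) : S3 q -> ~ hopf_fiber q north ->
  continuous (fun s : RR => stereo (hopf_rot q s)).
Proof.
move=> qS qn.
have cosc : continuous (fun s : RR => cos s) by exact: (@continuous_cos RR).
have sinc : continuous (fun s : RR => sin s) by exact: (@continuous_sin RR).
have cs (a b : RR) : continuous (fun s : RR => a * cos s - b * sin s).
  by apply: continuous_sub; apply: continuous_mul => //; exact: continuous_cst.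
have sc (a b : RR) : continuous (fun s : RR => a * sin s + b * cos s).
  by apply: continuous_add; apply: continuous_mul => //; exact: continuous_cst.
have dc : continuous (fun s : RR => (1 - (crd q 2 * sin s + crd q 3 * cos s))^-1).
  apply: continuous_inv => [s|]; last first.
    by apply: continuous_sub; [exact: continuous_cst|exact: sc].
  rewrite subr_eq0 gt_eqF//; have := S3_lt1 (S3_rot s qS).
  by rewrite !crd_mk4; apply=> n; apply: qn; exists s.
apply: continuous_row => i.
rewrite /stereo /mk3; under eq_fun do rewrite mxE !crd_mk4.
by case: i => -[|[|[|//]]] /= _; apply: continuous_mul.
Qed.

Lemma continuous_unstereo : continuous unstereo.
Proof.
apply: continuous_row => i; rewrite /unstereo /mk4.
under eq_fun do rewrite mxE !mulr2n !expr2.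
have c k : continuous (fun y : pt3 => crd y k) by exact: continuous_crd.
case: i => -[|[|[|[|//]]]] /= _; last first.
  apply: continuous_sub; last exact: continuous_cst.
  by do 2 ?apply: continuous_add; exact: continuous_mul.
all: exact: continuous_add.
Qed.

Lemma continuous_hopf_det (p : pt4) :
  continuous (fun x => (hopf_det p x).1) /\ continuous (fun x => (hopf_det p x).2).
Proof.
have c k a : continuous (fun x : pt4 => crd x k * a).
  by apply: continuous_mul; [exact: continuous_crd|exact: continuous_cst].
split; rewrite /hopf_det /=.
- by do 2 apply: continuous_sub => //.
- by apply: continuous_sub; apply: continuous_add.
Qed.

Definition ez : pt3 := mk3 0 0 1.

Lemma linked_shadow (F G : pt3 -> pt3) (p q : pt4) :
  continuous F -> continuous G -> cancel F G -> cancel G F ->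
  S3 p -> S3 q -> ~ hopf_fiber q north ->
  F @` (stereo @` hopf_fiber p) `<=` unit_cube ->
  F @` (stereo @` hopf_fiber q) `<=` unit_cube ->
  exists x t, [/\ (F @` (stereo @` hopf_fiber q)) x, 0 <= t &
    (F @` (stereo @` hopf_fiber p)) (x + t *: ez)].
Proof.
move=> cF cG FK GK pS qS qn; set B := F @` (_ @` hopf_fiber p).
set A := F @` (_ @` hopf_fiber q) => Bcube Acube.
apply: contrapT => noshadow.
pose f s := F (stereo (hopf_rot q s)).
have Af s : A (f s).
  by exists (stereo (hopf_rot q s)) => //; exists (hopf_rot q s) => //; exists s.
have cf : continuous f.
  exact: continuous_compose (continuous_stereo_rot qS qn) cF.
(* Time [0, 1] pushes the loop up above the cube, time [1, 2] contracts it there. *)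
pose Y (x : RR * RR) : pt3 :=
  (1 - Num.max (x.1 - 1) 0) *: f x.2 + (2 * Num.min x.1 1) *: ez.
have cY : continuous Y.
  apply: continuous_row => i; under eq_fun do rewrite /Y !mxE.
  have cfst : continuous (fun x : RR * RR => x.1) by move=> x; exact: cvg_fst.
  have csnd : continuous (fun x : RR * RR => x.2) by move=> x; exact: cvg_snd.
  have c := @continuous_cst (RR * RR)%type.
  apply: continuous_add; apply: continuous_mul => //.
  - apply: continuous_sub => // x.
    by apply: (@continuous_max RR _ (fun x : RR * RR => x.1 - 1) (fun=> 0));
      [exact: continuous_sub|exact: c].
  - exact: continuous_compose (continuous_compose csnd cf) (@continuous_coord 3 i).
  - apply: continuous_mul => // x.
    by apply: (@continuous_min RR _ (fun x : RR * RR => x.1) (fun=> 1));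
      [exact: cfst|exact: c].
have YB t s : 0 <= t <= 2 -> ~ B (Y (t, s)).
  move=> /andP[t0 t2]; have [t1|/ltW t1] := lerP t 1 => BY.
    apply: noshadow; exists (f s), (2 * t); split=> //; first by rewrite mulr_ge0.
    move: BY; rewrite /Y /= max_r ?subr_le0// min_l//.
    by rewrite subr0 scale1r.
  (* From time 1 on, the height is [2 - t] times that of [f s], plus 2, so it exceeds the top of the
     cube. *)
  have /andP[_] := Bcube _ BY (inord 2).
  rewrite /Y /= max_l ?subr_ge0// min_r// !mxE inordK//= mulr1 leNgt.
  have /andP[f0 _] := Acube _ (Af s) (inord 2).
  by apply/negP; rewrite negbK; nra.
(* The homotopy is pulled back by [G] and sent to the punctured plane. At time 0 it is the circle
   through [hopf_det p q], scaled by the factor [l] of [unstereoK]. *)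
pose h x := hopf_det p (unstereo (G (Y x))).
have [cd1 cd2] := continuous_hopf_det p.
have cu : continuous (fun x => unstereo (G (Y x))).
  exact: continuous_compose (continuous_compose cY cG) continuous_unstereo.
pose l s := 2 / (1 - crd (hopf_rot q s) 3).
have l0 s : 0 < l s.
  rewrite divr_gt0// subr_gt0; apply: S3_lt1; first exact: S3_rot.
  by move=> n; apply: qn; exists s.
apply: (circle_not_null_homotopic (h := h) (A := 2) (l := l) (c := hopf_det p q) _ _ _ _ _ _ l0) => //.
- exact: continuous_compose cu cd1.
- exact: continuous_compose cu cd2.
- move=> t s t2 _ h0; apply: (YB t s t2).
  by exists (G (Y (t, s))); [exact: hopf_det_unstereo_eq0|rewrite GK].
- move=> t _; rewrite /h /Y /f /=.
  by rewrite /hopf_rot cos2pi sin2pi cos0 sin0.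
- move=> s _; rewrite /h /Y /= max_l; last by lra.
  by rewrite (_ : 1 - (2 - 1) = 0 :> RR) ?scale0r//; lra.
- move=> s _; rewrite /h /Y /= max_r; last by lra.
  rewrite min_l// mulr0 scale0r addr0 subr0 scale1r /f FK unstereoK.
  + by rewrite hopf_det_scale hopf_det_rot.
  + exact: S3_rot.
  + by move=> n; apply: qn; exists s.
Qed.

(** * Counting cells *)

(** Double counting: each element of [S] is counted for at most one index. *)
Lemma sum_card_disjoint (I T : finType) (A : I -> {set T}) (P : pred I) (S : {set T}) :
  (forall i j x, x \in A i -> x \in A j -> i = j) ->
  (\sum_(i | P i) #|A i :&: S| <= #|S|)%N.
Proof.
move=> disjA.
have cardE i : #|A i :&: S| = (\sum_(x in S) (x \in A i))%N.
  rewrite -sum1_card (eq_bigl (fun x => (x \in S) && (x \in A i))); last first.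
    by move=> x; rewrite inE andbC.
  by rewrite big_mkcondr; apply: eq_bigr => x _; case: (x \in A i).
under eq_bigr => i _ do rewrite cardE.
rewrite exchange_big -sum1_card; apply: leq_sum => x xS.
have [/existsP[i xi]|] := boolP [exists i, x \in A i]; last first.
  by rewrite negb_exists => /forallP xA; rewrite big1// => i _; rewrite (negbTE (xA i)).
rewrite big_mkcond (leq_trans (n := \sum_k (k == i))%N)//; last first.
  by rewrite (bigD1 i)//= eqxx big1// => k /negbTE ->.
apply: leq_sum => k _; case: (P k) => //; have [xk|//] := boolP (x \in A k).
by rewrite (disjA k i x)// eqxx.
Qed.

Lemma shadow_count (n m : nat) (A : 'I_n -> {set 'I_m * 'I_m * 'I_m}) : (0 < n)%N ->
  (forall i j c, c \in A i -> c \in A j -> i = j) ->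
  (forall i j, i != j -> exists c d, [/\ c \in A i, d \in A j & c.1 = d.1]) ->
  (n * n.-1 <= m ^ 4)%N.
Proof.
move=> n0 disjA colA.
have [i iA] : exists i, (n * #|A i| <= m ^ 3)%N.
  (* Pigeonhole: otherwise, summing over [i], the disjoint sets would contain more than [m ^ 3]
     cells in total. *)
  apply/existsP; apply: contraT; rewrite negb_exists => /forallP nA.
  have : (\sum_(i < n) (m ^ 3).+1 <= n * \sum_(i < n) #|A i :&: [set: _]%SET|)%N.
    by rewrite big_distrr; apply: leq_sum => i _; rewrite finset.setIT ltnNge.
  rewrite sum_nat_const card_ord leq_mul2l gtn_eqF//= ltnNge => /negP[].
  apply: leq_trans (sum_card_disjoint _ _ disjA) _.
  by rewrite cardsT !card_prod !card_ord !expnS expn0 muln1 mulnA.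
(* [S] consists of the full vertical columns through the cells of [A i]. Every other [A j] meets it,
   in cells of its own. *)
pose S := finset.setX [set c.1 | c in A i]%SET [set: 'I_m]%SET.
have nS : (n.-1 <= #|S|)%N.
  rewrite -[n in n.-1]card_ord -(cardC1 i) -(sum1_card (predC1 i)).
  apply: leq_trans (sum_card_disjoint (predC1 i) S disjA); apply: leq_sum => j.
  rewrite inE eq_sym => /colA[c [d [ci dj cd]]]; apply/card_gt0P; exists d.
  by rewrite !inE dj -cd imset_f.
rewrite expnSr; apply: leq_trans (leq_mul iA (leqnn m)); rewrite -mulnA leq_mul2l.
apply/orP; right; apply: leq_trans nS _.
by rewrite cardsX cardsT card_ord leq_mul2r leq_imset_card orbT.
Qed.

(** There are [k.+1] indices per axis because a coordinate equal to 1 gets the index [k]. *)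
Definition cell (k : nat) (x : pt3) : 'I_k.+1 * 'I_k.+1 * 'I_k.+1 :=
  let c i : 'I_k.+1 := inord (Num.trunc (k%:R * crd x i)) in (c 0%N, c 1%N, c 2).

Lemma eucl_dist_crd (x y : pt3) : eucl_dist x y =
  Num.sqrt ((crd x 0 - crd y 0) ^+ 2 + (crd x 1 - crd y 1) ^+ 2 + (crd x 2 - crd y 2) ^+ 2).
Proof.
rewrite /eucl_dist (mk3_crd x) (mk3_crd y) !crd_mk3 !big_ord_recl big_ord0 !mxE /=.
by rewrite addr0 !addrA.
Qed.

Lemma inord_trunc_eq (k : nat) (a b : RR) : (0 < k)%N -> 0 <= a <= 1 -> 0 <= b <= 1 ->
  inord (Num.trunc (k%:R * a)) = inord (Num.trunc (k%:R * b)) :> 'I_k.+1 ->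
  `|a - b| < k%:R^-1.
Proof.
move=> k0 /andP[a0 a1] /andP[b0 b1] /(congr1 val) /=.
have k0' : 0 < k%:R :> RR by rewrite ltr0n.
have trunc_lt (c : RR) : c <= 1 -> (Num.trunc (k%:R * c) < k.+1)%N.
  move=> c1; rewrite ltnS truncn_le_nat; apply: (le_lt_trans (y := k%:R)); last by rewrite ltr_nat.
  by rewrite ler_piMr// ltW.
rewrite !inordK ?trunc_lt// => ab.
have /andP[] := truncn_itv (mulr_ge0 (ltW k0') a0).
have /andP[] := truncn_itv (mulr_ge0 (ltW k0') b0).
rewrite ab -natr1; move: (Num.trunc _)%:R => c h1 h2 h3 h4.
rewrite -(ltr_pM2l k0') -{1}(gtr0_norm k0') -normrM mulrBr divff ?gt_eqF// ltr_norml.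
by apply/andP; split; lra.
Qed.

(** Each coordinate differs by less than [1 / k], and the square root of 3 is below 2. *)
Lemma cell_eq_dist (k : nat) (x y : pt3) : (0 < k)%N -> unit_cube x -> unit_cube y ->
  cell k x = cell k y -> eucl_dist x y < 2 / k%:R.
Proof.
move=> k0 xc yc [e0 e1 e2].
have k0' : 0 < k%:R :> RR by rewrite ltr0n.
have d (i : nat) : inord (Num.trunc (k%:R * crd x i)) =
      inord (Num.trunc (k%:R * crd y i)) :> 'I_k.+1 ->
    (crd x i - crd y i) ^+ 2 < k%:R^-1 ^+ 2.
  move=> e; rewrite -real_normK ?num_real// ltr_pXn2r ?nnegrE ?invr_ge0 ?(ltW k0')//.
  by apply: inord_trunc_eq e => //; [exact: xc|exact: yc].
have := d _ e0; have := d _ e1; have := d _ e2 => d2 d1 d0.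
rewrite eucl_dist_crd -[ltRHS]ger0_norm ?divr_ge0 ?(ltW k0')// -sqrtr_sqr.
rewrite ltr_sqrt; first by rewrite exprMn; have := sqr_ge0 (k%:R^-1 : RR); lra.
by rewrite exprn_gt0// divr_gt0.
Qed.

(** * The bound for links in the cube *)

Lemma link_shadow (n : nat) (K : 'I_n -> set pt3) (i j : 'I_n) :
  is_link_Ln K -> (forall i, K i `<=` unit_cube) ->
  exists x t, [/\ K i x, 0 <= t & K j (x + t *: ez)].
Proof.
move=> [p [pS [pn [_ [H [[_ [_ Hh]] HK]]]]]] Kc.
have [|cH [g [cg [Hg gH]]]] := Hh 1; first by rewrite ler01 lexx.
rewrite -!HK; apply: (linked_shadow cH cg Hg gH) => //; rewrite HK; exact: Kc.
Qed.

Lemma eucl_dist_cube (x y : pt3) : unit_cube x -> unit_cube y -> eucl_dist x y <= 2.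
Proof.
move=> xc yc; rewrite eucl_dist_crd -[leRHS]ger0_norm// -sqrtr_sqr ler_sqrt ?sqr_ge0//.
have d k : (crd x k - crd y k) ^+ 2 <= 1.
  have /andP[x0 x1] := xc (inord k); have /andP[y0 y1] := yc (inord k).
  by rewrite -real_normK ?num_real// expr_le1// /crd ler_norml; apply/andP; split; lra.
by have := d 0%N; have := d 1%N; have := d 2; lra.
Qed.

Lemma crd_ez (x : pt3) (t : RR) :
  (crd (x + t *: ez) 0 = crd x 0) * (crd (x + t *: ez) 1 = crd x 1).
Proof. by rewrite /crd /ez /mk3 !mxE !inordK //= mulr0 !addr0. Qed.

Theorem theorem7p1 :
  exists C : RR, 0 < C /\
    forall (n : nat), (2 <= n)%N ->
    forall (K : 'I_n -> set pt3) (eps : RR),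
      is_link_Ln K ->
      (forall i, K i `<=` unit_cube) ->
      (forall i j, i != j -> forall x y : pt3, x \in K i -> y \in K j -> eps <= eucl_dist x y) ->
      eps <= C / Num.sqrt (n%:R).
Proof.
(* The constant 8 works because [2 * 6 ^ 4 <= 8 ^ 4]. *)
exists 8; split=> // n n2 K eps KL Kc Kd.
have [eps0|eps0] := lerP eps 0.
  by apply: (le_trans eps0); rewrite divr_ge0// sqrtr_ge0.
have n0 : (0 < n)%N by exact: ltn_trans n2.
have eps2 : eps <= 2.
  (* Using [link_shadow] with twice the same index only serves to pick a point of that component. *)
  have [x [_ [x1 _ _]]] := link_shadow (Ordinal n0) (Ordinal n0) KL Kc.
  have [y [_ [y1 _ _]]] := link_shadow (Ordinal n2) (Ordinal n2) KL Kc.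
  apply: (le_trans (Kd (Ordinal n0) (Ordinal n2) _ x y _ _)); rewrite ?inE//.
  by apply: eucl_dist_cube; [exact: Kc x1|exact: Kc y1].
(* This makes [2 / k < eps], so that two points of one cell are closer than [eps]. *)
pose k := (Num.trunc (2 / eps)).+1.
have k_gt : 2 / eps < k%:R by exact: truncnS_gt.
have k0 : 0 < k%:R :> RR by rewrite ltr0n.
have k_le : k%:R <= 2 / eps + 1.
  rewrite -(natr1 (Num.trunc (2 / eps))) lerD2r.
  by have /andP[] := truncn_itv (ltW (divr_gt0 (ltr0Sn _ 1) eps0)).
pose A i : {set 'I_k.+1 * 'I_k.+1 * 'I_k.+1} :=
  [set c | `[< exists2 x, K i x & cell k x = c >]]%SET.
have AE i c : c \in A i <-> exists2 x, K i x & cell k x = c.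
  by rewrite inE; split=> /asboolP.
have : (n * n.-1 <= k.+1 ^ 4)%N.
  apply: (shadow_count n0 (A := A)) => [i j c /AE[x xi <-] /AE[y yj yx]|i j _].
    apply/eqP/negPn/negP => ij.
    have := Kd i j ij x y; rewrite !inE => /(_ xi yj); apply/negP; rewrite -ltNge.
    apply: (lt_trans (cell_eq_dist (k := k) _ (Kc _ _ xi) (Kc _ _ yj) _)) => //.
    by rewrite ltr_pdivrMr// mulrC -ltr_pdivrMr.
  have [x [t [xi _ xj]]] := link_shadow i j KL Kc.
  exists (cell k x), (cell k (x + t *: ez)); split.
  - by apply/AE; exists x.
  - by apply/AE; exists (x + t *: ez).
  - by rewrite /cell /= !crd_ez.
rewrite -(ler_nat RR) natrM natrX => nk.
(* From [2 <= n]; it turns the count into [n ^ 2 <= 2 * k.+1 ^ 4]. *)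
have n1 : n%:R <= 2 * n.-1%:R :> RR.
  by rewrite -natrM ler_nat; clear -n2; lia.
(* The product is at most [2 + 2 * eps], and [eps <= 2]. *)
have epsk : eps * k.+1%:R <= 6.
  rewrite -(natr1 k); apply: (le_trans (y := eps * (2 / eps + 2))).
    by rewrite ler_pM2l//; lra.
  by rewrite mulrDr mulrCA divff ?gt_eqF//; lra.
have epsn : (eps ^+ 2 * n%:R) ^+ 2 <= 64 ^+ 2.
  apply: (le_trans (y := 2 * (eps * k.+1%:R) ^+ 4)); last first.
    have : (eps * k.+1%:R) ^+ 4 <= 6 ^+ 4.
      by apply: lerXn2r; rewrite ?nnegrE ?mulr_ge0 ?(ltW eps0).
    lra.
  have -> : (eps ^+ 2 * n%:R) ^+ 2 = eps ^+ 4 * n%:R ^+ 2 by ring.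
  have -> : 2 * (eps * k.+1%:R) ^+ 4 = eps ^+ 4 * (2 * k.+1%:R ^+ 4) by ring.
  rewrite ler_pM2l ?exprn_gt0//.
  apply: (le_trans _ (ler_wpM2l _ nk)) => //.
  by rewrite expr2 mulrCA ler_wpM2l.
have sn : 0 < Num.sqrt n%:R :> RR by rewrite sqrtr_gt0 ltr0n.
(* Comparing fourth powers removes the square root: that of [eps * sqrt n] is
   [(eps ^ 2 * n) ^ 2]. *)
rewrite ler_pdivlMr// -(@ler_pXn2r _ 4)// ?nnegrE ?mulr_ge0 ?(ltW eps0) ?(ltW sn)//.
have -> : (eps * Num.sqrt n%:R) ^+ 4 = (eps ^+ 2 * Num.sqrt n%:R ^+ 2) ^+ 2 by ring.
rewrite sqr_sqrtr//; apply: (le_trans epsn).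
by rewrite (_ : 8 ^+ 4 = 64 ^+ 2 :> RR)//; ring.
Qed.
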